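(* Let $Q$ be a quandle and $\hat{Q}$ its profinite completion. Then $Q$ is residually finite if and only if the canonical map $\eta: Q \to \hat{Q}$ is injective.
   Context: A quandle is a non-empty set $Q$ with a binary operation $*$ such that (Q1) $x*x=x$ for all $x\in Q$; (Q2) for all $x,y\in Q$ there is a unique $z\in Q$ with $x=z*y$ (write $z=x*^{-1}y$); (Q3) $(x*y)*z=(x*z)*(y*z)$ for all $x,y,z\in Q$. A homomorphism of quandles is a map preserving $*$. $Q$ is residually finite if for any distinct $a,b\in Q$ there exist a finite quandle $F$ and a homomorphism $f:Q\to F$ with $f(a)\neq f(b)$. A congruence on $Q$ is an equivalence relation compatible with both $*$ and $*^{-1}$; it is of finite index if the quotient quandle $Q/\alpha$ is finite. Let $\mathcal{F}$ be the set of all finite index congruences on $Q$, directed by reverse inclusion ($\alpha\le\beta$ iff $\alpha\supseteq\beta$). The quotients $Q/\gamma$, $\gamma\in\mathcal{F}$, with the canonical quotient maps $\varphi_{\alpha\beta}:Q/\beta\to Q/\alpha$ for $\alpha\le\beta$, form a projective system of quandles; its projective limit $\hat{Q}=\{(x_\gamma)_\gamma\in\prod_{\gamma\in\mathcal{F}} Q/\gamma : \varphi_{\alpha\beta}(x_\beta)=x_\alpha \text{ for all } \alpha\le\beta\}$ is the profinite completion of $Q$. The canonical homomorphism $\eta:Q\to\hat{Q}$ is $\eta(q)=([q]_\gamma)_{\gamma\in\mathcal{F}}$, where $[q]_\gamma$ is the class of $q$ modulo $\gamma$. *)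

(* Defs.v *)
From HB Require Import structures.
From mathcomp Require Import all_boot.
From mathcomp Require Import boolp classical_sets functions cardinality.

Set Implicit Arguments.
Unset Strict Implicit.
Unset Printing Implicit Defensive.

Declare Scope quandle_scope.
Delimit Scope quandle_scope with Qd.
Local Open Scope classical_set_scope.
Local Open Scope quandle_scope.

Lemma sval_inj (T : Type) (P : T -> Prop) : injective (@sval T P).
Proof. by apply: eq_sig_hprop => x p q; exact: Prop_irrelevance. Qed.

HB.mixin Record isQuandle (Q : Type) := {
  qop : Q -> Q -> Q;
  quandle_inhabited : inhabited Q;
  qopxx : forall x, qop x x = x;
  qop_exists_unique : forall x y, exists! z, x = qop z y;
  qopDr : forall x y z, qop (qop x y) z = qop (qop x z) (qop y z)
}.

#[short(type="quandleType")]
HB.structure Definition Quandle := { Q of isQuandle Q }.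

Notation "x * y" := (qop x y) : quandle_scope.

Definition qinv (Q : quandleType) (x y : Q) : Q :=
  sval (cid (qop_exists_unique x y)).

Definition quandle_morphism (Q Q' : quandleType) (f : Q -> Q') : Prop :=
  forall x y, f (x * y) = f x * f y.

Definition residually_finite (Q : quandleType) : Prop :=
  forall a b : Q, a <> b ->
    exists (F : quandleType) (f : Q -> F),
      [/\ finite_set [set: F], quandle_morphism f & f a <> f b].

Section QinvTheory.
Variable Q : quandleType.
Implicit Types x y z : Q.

Lemma qinvK x y : qinv x y * y = x.
Proof. by rewrite /qinv; case: cid => z [/= ? _]. Qed.

Lemma qopI x y z : x * z = y * z -> x = y.
Proof.
move=> e; have [t [_ u]] := qop_exists_unique (x * z) z.
by rewrite -(u x) // -(u y).
Qed.

Lemma qopK x y : qinv (x * y) y = x.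
Proof. by apply: (@qopI _ _ y); rewrite qinvK. Qed.

End QinvTheory.

Record congruence (Q : quandleType) := Congruence {
  cong_rel :> Q -> Q -> Prop;
  cong_refl : forall x, cong_rel x x;
  cong_sym : forall x y, cong_rel x y -> cong_rel y x;
  cong_trans : forall x y z, cong_rel x y -> cong_rel y z -> cong_rel x z;
  cong_qop : forall x x' y y',
    cong_rel x x' -> cong_rel y y' -> cong_rel (x * y) (x' * y');
  cong_qinv : forall x x' y y',
    cong_rel x x' -> cong_rel y y' -> cong_rel (qinv x y) (qinv x' y')
}.

Definition cong_quot (Q : quandleType) (a : congruence Q) : Type :=
  {A : set Q | exists q, A = [set x | a q x]}.

Definition cong_class (Q : quandleType) (a : congruence Q) (q : Q) :
  cong_quot a := exist _ [set x | a q x] (ex_intro _ q erefl).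

Definition class_repr (Q : quandleType) (a : congruence Q)
  (A : cong_quot a) : Q := sval (cid (svalP A)).

Section QuotientQuandle.
Variables (Q : quandleType) (a : congruence Q).
Implicit Types (x y : Q) (A B C : cong_quot a).

Lemma eq_cong_class x y : cong_class a x = cong_class a y <-> a x y.
Proof.
split=> [/(congr1 sval)/= e|axy].
  by have : [set z | a y z] y by [exact: cong_refl]; rewrite -e.
apply: sval_inj; apply/seteqP; split=> z /= h.
  exact: cong_trans (cong_sym axy) h.
exact: cong_trans axy h.
Qed.

Lemma class_reprK A : cong_class a (class_repr A) = A.
Proof.
by apply: sval_inj; rewrite /class_repr; case: cid => q /= ->.
Qed.

(* Well defined on classes: see quot_qopE. *)
Definition quot_qop A B : cong_quot a :=
  cong_class a (class_repr A * class_repr B).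

Lemma quot_qopE x y :
  quot_qop (cong_class a x) (cong_class a y) = cong_class a (x * y).
Proof.
by apply/eq_cong_class; apply: cong_qop; apply/eq_cong_class;
  rewrite class_reprK.
Qed.

Lemma quot_inhabited : inhabited (cong_quot a).
Proof. by have [q] := @quandle_inhabited Q; split; exact: (cong_class a q). Qed.

Lemma quot_qopxx A : quot_qop A A = A.
Proof. by rewrite -(class_reprK A) quot_qopE qopxx. Qed.

Lemma quot_qop_exists_unique A B : exists! C, A = quot_qop C B.
Proof.
rewrite -(class_reprK A) -(class_reprK B).
move: (class_repr A) (class_repr B) => x y.
exists (cong_class a (qinv x y)); split=> [|C]; first by rewrite quot_qopE qinvK.
rewrite -(class_reprK C) quot_qopE => /eq_cong_class axz.
apply/eq_cong_class; rewrite -[class_repr C](qopK _ y).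
exact: cong_qinv axz (cong_refl _ _).
Qed.

Lemma quot_qopDr A B C :
  quot_qop (quot_qop A B) C = quot_qop (quot_qop A C) (quot_qop B C).
Proof.
by rewrite -(class_reprK A) -(class_reprK B) -(class_reprK C) !quot_qopE qopDr.
Qed.

HB.instance Definition _ := isQuandle.Build (cong_quot a)
  quot_inhabited quot_qopxx quot_qop_exists_unique quot_qopDr.

Lemma cong_class_morphism : quandle_morphism (cong_class a).
Proof. by move=> x y; rewrite -quot_qopE. Qed.

End QuotientQuandle.

Record fin_congruence (Q : quandleType) := FinCongruence {
  fin_cong :> congruence Q;
  fin_cong_index : finite_set [set: cong_quot fin_cong]
}.

(* Reverse inclusion: the larger relation is the smaller element. *)
Definition fcong_le (Q : quandleType) (a b : fin_congruence Q) : Prop :=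
  forall x y, b x y -> a x y.

(* The canonical map Q/b -> Q/a sending [q]_b to [q]_a: see quot_mapE. *)
Definition quot_map (Q : quandleType) (a b : fin_congruence Q)
    (ab : fcong_le a b) (A : cong_quot b) : cong_quot a :=
  cong_class a (class_repr A).

Lemma quot_mapE (Q : quandleType) (a b : fin_congruence Q)
  (ab : fcong_le a b) (q : Q) :
  quot_map ab (cong_class b q) = cong_class a q.
Proof. by apply/eq_cong_class/ab/eq_cong_class; rewrite class_reprK. Qed.

Lemma quot_map_morphism (Q : quandleType) (a b : fin_congruence Q)
  (ab : fcong_le a b) : quandle_morphism (quot_map ab).
Proof.
move=> A B; rewrite -(class_reprK A) -(class_reprK B).
by rewrite -cong_class_morphism !quot_mapE cong_class_morphism.
Qed.

Definition coherent (Q : quandleType)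
    (x : forall c : fin_congruence Q, cong_quot c) : Prop :=
  forall (a b : fin_congruence Q) (ab : fcong_le a b),
    quot_map ab (x b) = x a.

Definition profinite_completion (Q : quandleType) : Type :=
  {x : forall c : fin_congruence Q, cong_quot c | coherent x}.

Definition profinite_eta (Q : quandleType) (q : Q) : profinite_completion Q :=
  exist (@coherent Q) (fun c : fin_congruence Q => cong_class c q)
    (fun a b ab => quot_mapE ab q).

Section CompletionQuandle.
Variable Q : quandleType.
Implicit Types x y z : profinite_completion Q.

Lemma completion_eq x y : (forall c, sval x c = sval y c) -> x = y.
Proof.
by move=> e; apply: sval_inj; apply: functional_extensionality_dep.
Qed.

Lemma completion_qop_subproof x y (a b : fin_congruence Q)
  (ab : fcong_le a b) :
  quot_map ab (sval x b * sval y b) = sval x a * sval y a.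
Proof. by rewrite quot_map_morphism (svalP x) (svalP y). Qed.

Definition completion_qop x y : profinite_completion Q :=
  exist (@coherent Q) (fun c : fin_congruence Q => sval x c * sval y c)
    (@completion_qop_subproof x y).

Lemma completion_inhabited : inhabited (profinite_completion Q).
Proof. by have [q] := @quandle_inhabited Q; split; exact: profinite_eta q. Qed.

Lemma completion_qopxx x : completion_qop x x = x.
Proof. by apply: completion_eq => c /=; rewrite qopxx. Qed.

Lemma completion_qinv_subproof x y (a b : fin_congruence Q)
  (ab : fcong_le a b) :
  quot_map ab (qinv (sval x b) (sval y b)) = qinv (sval x a) (sval y a).
Proof.
apply: (@qopI _ _ _ (sval y a)); rewrite qinvK -(svalP y a b ab).
by rewrite -quot_map_morphism qinvK (svalP x).
Qed.

Lemma completion_qop_exists_unique x y : exists! z, x = completion_qop z y.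
Proof.
exists (exist (@coherent Q) (fun c : fin_congruence Q => qinv (sval x c) (sval y c))
  (@completion_qinv_subproof x y)); split=> [|z ->].
  by apply: completion_eq => c /=; rewrite qinvK.
by apply: completion_eq => c /=; rewrite qopK.
Qed.

Lemma completion_qopDr x y z :
  completion_qop (completion_qop x y) z =
  completion_qop (completion_qop x z) (completion_qop y z).
Proof. by apply: completion_eq => c /=; rewrite qopDr. Qed.

HB.instance Definition _ := isQuandle.Build (profinite_completion Q)
  completion_inhabited completion_qopxx completion_qop_exists_unique
  completion_qopDr.

Lemma profinite_eta_morphism : quandle_morphism (@profinite_eta Q).
Proof. by move=> x y; apply: completion_eq => c; exact: cong_class_morphism. Qed.

End CompletionQuandle.

(* Main.v *)
Require Import Defs.
From HB Require Import structures.
From mathcomp Require Import all_boot.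
From mathcomp Require Import boolp classical_sets cardinality.

(** Two points of [Q] have the same image under [profinite_eta] exactly when
    every finite index congruence relates them ([eq_profinite_eta]). So
    injectivity of [profinite_eta] means that distinct points are separated by
    some finite index congruence, and residual finiteness means that they are
    separated by some morphism to a finite quandle. These agree because finite
    index congruences and kernels of morphisms to finite quandles are the same
    relations: a finite index congruence is the kernel of its quotient map, and
    conversely the kernel of a morphism to a finite quandle is a congruence
    whose quotient embeds in that quandle ([finite_kernel_quot]). *)

Set Implicit Arguments.
Unset Strict Implicit.
Unset Printing Implicit Defensive.

Local Open Scope classical_set_scope.
Local Open Scope quandle_scope.

(** Right division is determined by the product, through uniqueness in (Q2),
    so it is preserved as well. *)
Lemma quandle_morphism_qinv (Q F : quandleType) (f : Q -> F) :
  quandle_morphism f -> forall x y, f (qinv x y) = qinv (f x) (f y).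
Proof. by move=> fM x y; apply: (@qopI _ _ _ (f y)); rewrite -fM !qinvK. Qed.

Section Kernel.
Variables (Q F : quandleType) (f : Q -> F) (fM : quandle_morphism f).

Definition kernel_congruence : congruence Q.
Proof.
apply: (@Congruence Q (fun x y => f x = f y)) => //.
- by move=> x y z -> ->.
- by move=> x x' y y' fx fy; rewrite !fM fx fy.
- by move=> x x' y y' fx fy; rewrite !quandle_morphism_qinv// fx fy.
Defined.

(** Evaluating [f] at representatives embeds the quotient into [F]. *)
Lemma finite_kernel_quot :
  finite_set [set: F] -> finite_set [set: cong_quot kernel_congruence].
Proof.
move=> finF; pose g (A : cong_quot kernel_congruence) := f (class_repr A).
rewrite -(preimage_setT g); apply: finite_preimage => // A B _ _ gAB.
by rewrite -(class_reprK A) -(class_reprK B); apply/eq_cong_class.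
Qed.

End Kernel.

Lemma eq_profinite_eta (Q : quandleType) (a b : Q) :
  profinite_eta a = profinite_eta b <-> forall c : fin_congruence Q, c a b.
Proof.
split=> [eab c | cab].
  by apply/eq_cong_class; have := congr1 (fun x => sval x c) eab.
by apply: completion_eq => c; apply/eq_cong_class.
Qed.

Theorem proposition3p5 (Q : quandleType) :
  residually_finite Q <-> injective (@profinite_eta Q).
Proof.
split=> [rfQ a b /eq_profinite_eta cab | eta_inj a b neq_ab].
  apply: contrapT => /rfQ[F [f [finF fM]]]; apply.
  exact: (cab (FinCongruence (finite_kernel_quot fM finF))).
have /existsNP[c ncab] : ~ forall c : fin_congruence Q, c a b.
  by move=> /eq_profinite_eta/eta_inj.
exists (cong_quot c), (cong_class c); split.
- exact: fin_cong_index.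
- exact: cong_class_morphism.
- by move=> /eq_cong_class.
Qed.
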